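(* Let $G_1$ and $G_2$ be two connected graphs, each with $n$ vertices and $m$ edges, having signless Laplacian spectra $0<\mu^+_n<\mu^+_{n-1}\leq\cdots\leq\mu^+_1$ and $0<\lambda^+_n<\lambda^+_{n-1}\leq\cdots\leq\lambda^+_1$, respectively. Let $p>n$ be a positive integer such that $$\frac{2m}{p+n}<\min(\mu^+_{n},\lambda^+_{n}).$$ Then $LE^+((G_1\cup\overline{K_p})\otimes K_p)=LE^+((G_2\cup\overline{K_p})\otimes K_p)$.
   Context: All graphs are finite, undirected and simple. For a graph $G$ with $N$ vertices and $M$ edges, adjacency matrix $A(G)$ and diagonal degree matrix $D(G)$, the signless Laplacian matrix is $L^+(G)=D(G)+A(G)$; its eigenvalues with multiplicity, $\mu^+_1,\dots,\mu^+_N$, form the signless Laplacian spectrum of $G$. The signless Laplacian energy is $LE^+(G)=\sum_{i=1}^{N}\left|\mu^+_i-\frac{2M}{N}\right|$. $K_p$ is the complete graph on $p$ vertices, $\overline{K_p}$ the graph on $p$ vertices with no edges, and $G\cup H$ the disjoint union. $G\otimes H$ is the Kronecker product (conjunction): vertex set $V(G)\times V(H)$, with $(u_1,v_1)$ adjacent to $(u_2,v_2)$ iff $u_1u_2\in E(G)$ and $v_1v_2\in E(H)$. *)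

(* Defs.v *)
From HB Require Import structures.
From mathcomp Require Import all_boot all_order all_algebra.

Set Implicit Arguments.
Unset Strict Implicit.
Unset Printing Implicit Defensive.

Import Order.TTheory GRing.Theory Num.Theory.
Local Open Scope ring_scope.

Record sgraph := SGraph {
  vertex :> finType;
  adj : rel vertex;
  adj_sym : symmetric adj;
  adj_irrefl : irreflexive adj
}.

Definition edges (G : sgraph) : {set {set G}} :=
  [set e | [exists x : G, exists y : G, adj x y && (e == [set x; y])]].

Definition degree (G : sgraph) (x : G) : nat := #|[set y | adj x y]|.

Definition connected (G : sgraph) : Prop :=
  (0 < #|G|)%N /\ forall x y : G, connect (@adj G) x y.

Lemma complete_sym p : symmetric (fun i j : 'I_p => i != j).
Proof. by move=> i j; rewrite eq_sym. Qed.

Lemma complete_irrefl p : irreflexive (fun i j : 'I_p => i != j).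
Proof. by move=> i; rewrite eqxx. Qed.

Definition complete (p : nat) : sgraph :=
  SGraph (@complete_sym p) (@complete_irrefl p).

Definition edgeless (p : nat) : sgraph :=
  @SGraph 'I_p (fun _ _ => false) (fun _ _ => erefl) (fun _ => erefl).

Section Union.
Variables G H : sgraph.

Definition union_adj (u v : G + H) : bool :=
  match u, v with
  | inl x, inl y => adj x y
  | inr x, inr y => adj x y
  | _, _ => false
  end.

Lemma union_sym : symmetric union_adj.
Proof. by case=> x [] y //=; rewrite adj_sym. Qed.

Lemma union_irrefl : irreflexive union_adj.
Proof. by case=> x /=; rewrite adj_irrefl. Qed.

Definition disjoint_union : sgraph := SGraph union_sym union_irrefl.
End Union.

Section Kronecker.
Variables G H : sgraph.

Definition kronecker_adj (u v : G * H) : bool :=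
  adj u.1 v.1 && adj u.2 v.2.

Lemma kronecker_sym : symmetric kronecker_adj.
Proof. by move=> u v; rewrite /kronecker_adj adj_sym [adj u.2 _]adj_sym. Qed.

Lemma kronecker_irrefl : irreflexive kronecker_adj.
Proof. by move=> u; rewrite /kronecker_adj adj_irrefl. Qed.

Definition kronecker : sgraph := SGraph kronecker_sym kronecker_irrefl.
End Kronecker.

Section SignlessLaplacian.
Variable C : numClosedFieldType.

(* Eigenvalues counted with algebraic multiplicity, in unspecified order; they
   are taken in the closed field C so that the full list always exists. *)
Definition spectrum (N : nat) (A : 'M[C]_N) : seq C :=
  sval (closed_field_poly_normal (char_poly A)).

Lemma spectrumP (N : nat) (A : 'M[C]_N) :
  char_poly A = \prod_(x <- spectrum A) ('X - x%:P).
Proof.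
rewrite /spectrum; case: closed_field_poly_normal => s /= {1}->.
by rewrite (monicP (char_poly_monic A)) scale1r.
Qed.

Variable G : sgraph.

(* Matrix indices enumerate the vertices through enum_val. *)
Definition adjacency_mx : 'M[C]_#|G| :=
  \matrix_(i, j) (adj (enum_val i) (enum_val j))%:R.

Definition degree_mx : 'M[C]_#|G| :=
  diag_mx (\row_i (degree (enum_val i))%:R).

Definition signless_laplacian : 'M[C]_#|G| := degree_mx + adjacency_mx.

Definition signless_spectrum : seq C := spectrum signless_laplacian.

Definition signless_energy : C :=
  \sum_(x <- signless_spectrum) `|x - (2 * #|edges G|)%:R / #|G|%:R|.
End SignlessLaplacian.

(* Main.v *)
(** Let p > n and c = 2m/(p+n). All signless Laplacian eigenvalues of G are at
    least c, so P = D + A - c is positive semidefinite. The spectrum of (G +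
    p K_1) (x) K_p is that of G (x) K_p together with p^2 zeros, with
    average (p - 1) c. On the part orthogonal to the constants of K_p the
    block G (x) K_p acts as (p - 1) D - A, whose relation to c is not given
    directly; it comes from the pinching inequality P <= n diag(P), valid
    for positive semidefinite n x n matrices. Hence every eigenvalue of G
    (x) K_p is at least (p - 1) c, all absolute values in the energy have a
    known sign, and the energy is determined by the trace, hence by n, m and
    p. *)
Require Import Defs.
From HB Require Import structures.
From mathcomp Require Import all_boot all_order all_algebra.
From mathcomp Require Import perm ring.

Set Implicit Arguments.
Unset Strict Implicit.
Unset Printing Implicit Defensive.

Import Order.TTheory GRing.Theory Num.Theory.
Local Open Scope ring_scope.

(** * Spectra and traces *)

Section Spectrum.
Variable C : numClosedFieldType.

Lemma mem_spectrum N (A : 'M[C]_N) a :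
  (a \in spectrum A) = eigenvalue A a.
Proof.
by rewrite eigenvalue_root_char spectrumP root_prod_XsubC.
Qed.

Lemma size_spectrum N (A : 'M[C]_N) : size (spectrum A) = N.
Proof.
by apply: succn_inj; rewrite -(size_char_poly A) spectrumP size_prod_XsubC.
Qed.

(** Both sides are, up to sign, the subleading coefficient of the characteristic polynomial; this
    coefficient exists only for [N > 0], hence the case split. *)
Lemma sum_spectrum N (A : 'M[C]_N) : \sum_(x <- spectrum A) x = \tr A.
Proof.
have [N0|N_gt0] := posnP N.
  have /size0nil -> : size (spectrum A) = 0%N by rewrite size_spectrum.
  by rewrite big_nil; case: N A N0 => // A _; rewrite /mxtrace big_ord0.
apply: oppr_inj; rewrite -char_poly_trace // spectrumP -{3}(size_spectrum A).
by rewrite coefPn_prod_XsubC // size_spectrum -lt0n.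
Qed.
End Spectrum.

(** * Sesquilinear forms of kernels on a finite type *)

Section Forms.
Variables (C : numClosedFieldType) (T : finType).
Implicit Types (K : T -> T -> C) (f g : T -> C).

(** Kernels are indexed by the vertices themselves, so sums and products of vertex types need no
    ordinal encoding; [kernel_mx] gives the matrix. *)
Definition sform K f g : C := \sum_x \sum_y K x y * (f x * (g y)^*).

(** In [C], [0 <= z] includes that [z] is real. *)
Definition psd K := forall f, 0 <= sform K f f.

Lemma eq_sform K K' f g f' g' :
  K =2 K' -> f =1 f' -> g =1 g' -> sform K f g = sform K' f' g'.
Proof.
by move=> eqK eqf eqg; do 2!apply: eq_bigr => ? _; rewrite eqK eqf eqg.
Qed.

Lemma sform_suml (I : finType) K (f : I -> T -> C) g :
  sform K (fun x => \sum_i f i x) g = \sum_i sform K (f i) g.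
Proof.
rewrite exchange_big; apply: eq_bigr => x _.
rewrite exchange_big; apply: eq_bigr => y _.
by rewrite mulr_suml mulr_sumr.
Qed.

Lemma sform_sumr (I : finType) K f (g : I -> T -> C) :
  sform K f (fun x => \sum_i g i x) = \sum_i sform K f (g i).
Proof.
rewrite exchange_big; apply: eq_bigr => x _.
rewrite exchange_big; apply: eq_bigr => y _.
by rewrite rmorph_sum !mulr_sumr.
Qed.

Lemma sform_subl K f f' g :
  sform K (fun x => f x - f' x) g = sform K f g - sform K f' g.
Proof.
rewrite -sumrB; apply: eq_bigr => x _; rewrite -sumrB; apply: eq_bigr => y _.
by rewrite mulrBl mulrBr.
Qed.

Lemma sform_subr K f g g' :
  sform K f (fun x => g x - g' x) = sform K f g - sform K f g'.
Proof.
rewrite -sumrB; apply: eq_bigr => x _; rewrite -sumrB; apply: eq_bigr => y _.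
by rewrite rmorphB !mulrBr.
Qed.

Lemma sform_kernel_lin a K K' f g :
  sform (fun x y => a * K x y + K' x y) f g = a * sform K f g + sform K' f g.
Proof.
rewrite mulr_sumr -big_split; apply: eq_bigr => x _.
rewrite mulr_sumr -big_split; apply: eq_bigr => y _ /=.
by rewrite mulrDl -mulrA.
Qed.

Lemma sform_diag (d : T -> C) f :
  sform (fun x y => d x *+ (x == y)) f f = \sum_x d x * `|f x| ^+ 2.
Proof.
apply: eq_bigr => x _; rewrite (bigD1 x) //= eqxx mulr1n normCK big1 ?addr0 //.
by move=> y /negPf; rewrite eq_sym => ->; rewrite mul0r.
Qed.

(* Sum over all [i], [j] the nonnegative values of the form at [f i - f j]. *)
Lemma psd_sum (I : finType) K (f : I -> T -> C) :
  psd K ->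
  sform K (fun x => \sum_i f i x) (fun x => \sum_i f i x)
    <= #|I|%:R * \sum_i sform K (f i) (f i).
Proof.
move=> K_psd; set s := fun x => _; set S := \sum_i _.
have ge0 : 0 <= \sum_i \sum_j
    sform K (fun x => f i x - f j x) (fun x => f i x - f j x).
  by apply: sumr_ge0 => i _; apply: sumr_ge0 => j _; apply: K_psd.
have sumE : \sum_i \sum_j
    sform K (fun x => f i x - f j x) (fun x => f i x - f j x) =
    2%:R * (#|I|%:R * S - sform K s s).
  transitivity (\sum_i (#|I|%:R * sform K (f i) (f i)
     - sform K (f i) s - sform K s (f i) + S)).
    apply: eq_bigr => i _.
    under eq_bigr => j _ do rewrite sform_subl !sform_subr opprB addrA addrAC.
    rewrite !big_split /= sumr_const !sumrN /s sform_sumr sform_suml.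
    by rewrite mulr_natl.
  rewrite !big_split /= !sumrN -mulr_sumr sumr_const -[S *+ _]mulr_natl.
  rewrite -sform_suml -sform_sumr -/s -/S; ring.
by rewrite -subr_ge0 -(pmulr_rge0 _ (ltr0n _ 2)) -sumE.
Qed.

Lemma sum_enum_val (F : T -> C) : \sum_x F x = \sum_(i < #|T|) F (enum_val i).
Proof. exact/reindex/onW_bij/enum_val_bij. Qed.

Definition kernel_mx K : 'M[C]_#|T| :=
  \matrix_(i, j) K (enum_val i) (enum_val j).
End Forms.

(** * Eigenvalue bounds as positivity of a form *)

Section Rayleigh.
Variable C : numClosedFieldType.
Local Open Scope sesquilinear_scope.

Lemma mul_row_adj n (v : 'rV[C]_n) :
  (v *m v ^t*) 0 0 = \sum_i `|v 0 i| ^+ 2.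
Proof.
by rewrite !mxE; apply: eq_bigr => i _; rewrite !mxE normCK.
Qed.

Lemma rayleigh n (A : 'M[C]_n) (t : C) : A \is hermsymmx ->
  (forall a, eigenvalue A a -> t <= a) ->
  forall v : 'rV_n, t * (v *m v ^t*) 0 0 <= (v *m A *m v ^t*) 0 0.
Proof.
move=> A_herm t_le v.
have /orthomx_spectralP := hermitian_normalmx A_herm.
set P := spectralmx A; set d := spectral_diag A => AE.
have P_unitary : P \is unitarymx := spectral_unitarymx A.
have P_unit := spectral_unit A; rewrite -/P in P_unit.
have d_eigen i : eigenvalue A (d 0 i).
  apply/eigenvalueP; exists (row i P).
    rewrite AE -row_mul !mulmxA mulmxV // mul1mx row_mul.
    by rewrite row_diag_mx -scalemxAl -rowE.
  (* A row of the invertible matrix [P] cannot vanish, so it is a genuine eigenvector. *)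
  apply: contraTneq P_unit => row0.
  apply/negP => /(mulmxV)/(congr1 (row i)); rewrite row_mul row0 mul0mx.
  by move/rowP/(_ i); rewrite !mxE eqxx => /esym/eqP; rewrite oner_eq0.
pose w := v *m P ^t*.
have vE : v = w *m P by rewrite mulmxKtV.
have wadj : w ^t* = P *m v ^t*.
  by rewrite /w trmx_mul map_mxM /= trmxCK.
have -> : v *m v ^t* = w *m w ^t* by rewrite wadj mulmxA -vE.
have -> : v *m A *m v ^t* = w *m diag_mx d *m w ^t*.
  by rewrite wadj AE invmx_unitary // !mulmxA.
rewrite mul_row_adj !mxE mulr_sumr; apply: ler_sum => i _.
rewrite mul_mx_diag !mxE.
rewrite mulrAC -normCK mulrC ler_wpM2l ?exprn_ge0 //.
exact/t_le/d_eigen.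
Qed.

(** Test the bound on an eigenvector and divide by its squared norm, which is positive. *)
Lemma rayleigh_inv n (A : 'M[C]_n) (t : C) :
  (forall v : 'rV_n, t * (v *m v ^t*) 0 0 <= (v *m A *m v ^t*) 0 0) ->
  forall a, eigenvalue A a -> t <= a.
Proof.
move=> tP a /eigenvalueP[v vA v_neq0].
have := tP v; rewrite vA -scalemxAl [leRHS]mxE ler_pM2r //.
rewrite mul_row_adj lt_def sumr_ge0 ?andbT => [|i _]; last exact: exprn_ge0.
apply: contra_neq v_neq0 => /eqP.
rewrite psumr_eq0 => [/allP v0|i _]; last exact: exprn_ge0.
apply/rowP => i; have := v0 i (mem_index_enum i).
by rewrite sqrf_eq0 normr_eq0 mxE => /eqP.
Qed.

Variable T : finType.
Implicit Type K : T -> T -> C.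

Lemma sform_kernel_mx K (f : T -> C) (v := \row_i f (enum_val i) : 'rV_#|T|) :
  sform K f f = (v *m kernel_mx K *m v ^t*) 0 0.
Proof.
rewrite !mxE /sform exchange_big /= sum_enum_val.
apply: eq_bigr => j _; rewrite !mxE mulr_suml sum_enum_val.
by apply: eq_bigr => i _; rewrite !mxE mulrCA mulrA.
Qed.

(** Used in both directions: to turn the bound on the spectrum of [G] into positivity, and to read a
    bound for the product off positivity. *)
Lemma spectrum_ge_psd K (t : C) : (forall x y, K x y = (K y x)^*) ->
  (forall a, a \in spectrum (kernel_mx K) -> t <= a) <->
  psd (fun x y => K x y - t *+ (x == y)).
Proof.
move=> K_herm.
have sformE f (v := \row_i f (enum_val i) : 'rV[C]_#|T|) :
    sform (fun x y => K x y - t *+ (x == y)) f f =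
    (v *m kernel_mx K *m v ^t*) 0 0 - t * (v *m v ^t*) 0 0.
  rewrite -sform_kernel_mx mul_row_adj.
  rewrite (eq_sform (K' := fun x y => -1 * (t *+ (x == y)) + K x y)
             (f' := f) (g' := f)) //; last by move=> x y; ring.
  rewrite sform_kernel_lin (sform_diag (fun=> t)) -mulr_sumr.
  rewrite sum_enum_val mulN1r addrC; congr (_ - _ * _).
  by apply: eq_bigr => i _; rewrite mxE.
split=> [t_le f | K_psd a].
  rewrite sformE subr_ge0 rayleigh // => [|a a_eig].
    apply/is_hermitianmxP/matrixP => i j.
    by rewrite !mxE expr0 mul1r K_herm.
  by apply: t_le; rewrite mem_spectrum.
rewrite mem_spectrum; apply: rayleigh_inv => v.
have := K_psd (fun x => v 0 (enum_rank x)); rewrite sformE subr_ge0.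
suff -> : \row_i v 0 (enum_rank (enum_val i)) = v by [].
by apply/rowP => i; rewrite mxE enum_valK.
Qed.
End Rayleigh.

(** * The pinching inequality and the product kernel *)

Section Pinching.
Variables (C : numClosedFieldType) (T I : finType).
Implicit Type P : T -> T -> C.

Lemma psd_diag_ge0 P x : psd P -> 0 <= P x x.
Proof.
move=> /(_ (fun y => (y == x)%:R)); rewrite /sform (bigD1 x) //= (bigD1 x) //=.
rewrite eqxx mulr1n rmorph1 !mulr1 !big1 ?addr0 // => y /negPf y_neq.
  by rewrite big1 // => z _; rewrite y_neq mul0r mulr0.
by rewrite y_neq rmorph0 !mulr0.
Qed.

(* Every vector is the sum of its #|T| coordinate parts. *)
Lemma psd_le_diag P f : psd P ->
  sform P f f <= #|T|%:R * \sum_x P x x * `|f x| ^+ 2.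
Proof.
move=> P_psd; have := psd_sum (fun i x => f x *+ (x == i)) P_psd.
have fE : (fun x => \sum_i f x *+ (x == i)) =1 f.
  move=> x; rewrite (bigD1 x) //= eqxx big1 ?addr0 // => i /negPf.
  by rewrite eq_sym => ->.
rewrite (eq_sform (K' := P) _ fE fE) //; congr (_ <= _ * _).
apply: eq_bigr => i _; rewrite /sform (bigD1 i) //= (bigD1 i) //= eqxx.
rewrite normCK !big1 ?addr0 // => x /negPf x_neq.
  by rewrite big1 // => z _; rewrite x_neq mul0r mulr0.
by rewrite x_neq rmorph0 !mulr0.
Qed.

Lemma big_pair (F : T * I -> C) : \sum_u F u = \sum_i \sum_x F (x, i).
Proof. by rewrite exchange_big pair_big; apply: eq_bigr => -[]. Qed.

(** With [D] and [A] the diagonal and off-diagonal parts of [P], and J the all-ones matrix on [I],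
    this is (p - 1) D (x) 1 + A (x) (J - 1), where p = [#|I|]. *)
Definition kron_kernel P (u v : T * I) : C :=
  if u.2 == v.2 then #|I|.-1%:R * P u.1 u.1 *+ (u.1 == v.1)
  else P u.1 v.1 *+ (u.1 != v.1).

(* Write P = D + A with D diagonal. Pinching gives R := (p - 1) D - A >= 0
   where p = #|I| >= #|T|. With f = (f_i) and s the sum of the f_i, the form of
   the kernel at f is the sum of the R[f_i] plus A[s], and p times the sum of
   the R[f_i] is at least R[s], while R + p A = (p - 1) P. *)
Lemma psd_kron_kernel P : (#|T| <= #|I|)%N -> psd P -> psd (kron_kernel P).
Proof.
move=> leTI P_psd F; set p := #|I| in leTI *; set q : C := p.-1%:R.
have [I0 | I_gt0] := posnP p.
  rewrite /sform big1 // => -[x i] _.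
  by have := card0_eq I0 i; rewrite inE.
have pE : p%:R = q + 1 :> C by rewrite /q natr1 prednK.
pose D x y := P x x *+ (x == y).
pose A x y := P x y *+ (x != y).
pose R x y := q * D x y + - A x y.
have D_form f : sform D f f = \sum_x P x x * `|f x| ^+ 2.
  exact: (sform_diag (fun x => P x x)).
have P_form f : sform P f f = sform D f f + sform A f f.
  rewrite -[sform D f f]mul1r -sform_kernel_lin; apply: eq_sform => // x y.
  rewrite /D /A mul1r.
  by have [->|_] := eqVneq x y; rewrite !(addr0, add0r).
have R_form f : sform R f f = q * sform D f f - sform A f f.
  rewrite /R sform_kernel_lin; congr (_ + _).
  rewrite /sform -sumrN; apply: eq_bigr => x _; rewrite -sumrN.
  by apply: eq_bigr => y _; rewrite mulNr.
have R_psd : psd R.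
  move=> f; rewrite R_form.
  have D_ge0 : 0 <= sform D f f.
    rewrite D_form sumr_ge0 // => x _.
    by rewrite mulr_ge0 ?psd_diag_ge0 ?exprn_ge0.
  have := psd_le_diag f P_psd; rewrite -D_form P_form => le1.
  have le2 : #|T|%:R * sform D f f <= p%:R * sform D f f.
    by rewrite ler_wpM2r // ler_nat.
  (* Adding [D[f]] to both sides turns the goal into [P[f] <= p * D[f]], which is pinching together
     with [#|T| <= p]. *)
  rewrite subr_ge0 -(lerD2l (sform D f f)).
  apply: le_trans (le_trans le1 le2) _.
  by rewrite pE mulrDl mul1r addrC.
pose f i x := F (x, i).
pose s x := \sum_i f i x.
have formE : sform (kron_kernel P) F F =
    \sum_i sform R (f i) (f i) + sform A s s.
  (* [A] is put on all pairs of blocks; on the diagonal blocks it cancels against the [- A] in [R],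
     leaving [q * D]. *)
  transitivity (\sum_i \sum_j ((if i == j then sform R (f i) (f j) else 0)
                  + sform A (f i) (f j))).
    transitivity (\sum_i \sum_j
        sform (fun x y => kron_kernel P (x, i) (y, j)) (f i) (f j)).
      rewrite /sform big_pair; apply: eq_bigr => i _.
      rewrite [RHS]exchange_big; apply: eq_bigr => x _.
      by rewrite big_pair.
    apply: eq_bigr => i _; apply: eq_bigr => j _; rewrite /kron_kernel /=.
    case: eqP => [->|_]; last by rewrite add0r.
    rewrite R_form subrK.
    rewrite -[q * _]addr0.
    have -> : 0 = sform (fun _ _ => 0) (f j) (f j).
      by rewrite /sform big1 // => x _; rewrite big1 // => y _; rewrite mul0r.
    rewrite -sform_kernel_lin; apply: eq_sform => // x y.
    by rewrite /D addr0 mulrnAr.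
  rewrite /s sform_suml -big_split; apply: eq_bigr => i _ /=.
  by rewrite big_split /= -big_mkcond sform_sumr (big_pred1 i).
have p_gt0 : 0 < p%:R :> C by rewrite ltr0n.
rewrite formE -(pmulr_rge0 _ p_gt0) mulrDr.
apply: le_trans (lerD (psd_sum f R_psd) (lexx _)).
rewrite R_form pE.
have -> : q * sform D s s - sform A s s + (q + 1) * sform A s s
  = q * sform P s s by rewrite P_form; ring.
by rewrite mulr_ge0 ?ler0n.
Qed.
End Pinching.

(** * Characteristic polynomials under reindexing and block decomposition *)

Section CharPoly.
Variable C : numClosedFieldType.

(** Two enumerations of [T] differ by a permutation applied to both rows and columns, so its sign
    enters the determinant twice and cancels. *)
Lemma char_poly_reindex (T : finType) (K : T -> T -> C) N (h : 'I_N -> T) :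
  bijective h ->
  char_poly (\matrix_(i, j) K (h i) (h j)) = char_poly (kernel_mx K).
Proof.
move=> h_bij; have eN : N = #|T| by rewrite -(bij_eq_card h_bij) card_ord.
subst N; have s_inj : injective (enum_rank \o h).
  exact: inj_comp enum_rank_inj (bij_inj h_bij).
pose s := perm s_inj.
rewrite /char_poly; have -> : char_poly_mx (\matrix_(i, j) K (h i) (h j)) =
    row_perm s (col_perm s (char_poly_mx (kernel_mx K))).
  apply/matrixP => i j.
  by rewrite !mxE !permE /= !enum_rankK (inj_eq s_inj).
rewrite row_permE col_permE !det_mulmx !det_perm odd_permV.
by rewrite mulrCA -signr_addb addbb mulr1.
Qed.

Lemma char_poly_kernel_bij (T T' : finType) (phi : T -> T')
    (K : T' -> T' -> C) : bijective phi ->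
  char_poly (kernel_mx (fun x y => K (phi x) (phi y))) =
  char_poly (kernel_mx K).
Proof.
move=> phi_bij.
exact: (char_poly_reindex K (bij_comp phi_bij (@enum_val_bij T))).
Qed.

Lemma char_poly_kernel_sum (T1 T2 : finType) (K : T1 + T2 -> T1 + T2 -> C) :
  (forall x y, K (inl x) (inr y) = 0) -> (forall x y, K (inr x) (inl y) = 0) ->
  char_poly (kernel_mx K) =
  char_poly (kernel_mx (fun x y => K (inl x) (inl y))) *
  char_poly (kernel_mx (fun x y => K (inr x) (inr y))).
Proof.
move=> Klr Krl.
pose h (i : 'I_(#|T1| + #|T2|)) : T1 + T2 :=
  match split i with inl a => inl (enum_val a) | inr b => inr (enum_val b) end.
have h_bij : bijective h.
  exists (fun u => unsplit (match u with
    inl x => inl (enum_rank x) | inr y => inr (enum_rank y) end)).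
    move=> i; rewrite /h -[RHS]splitK.
    by case: (split i) => a; rewrite enum_valK.
  by case=> x; rewrite /h unsplitK enum_rankK.
rewrite -(char_poly_reindex K h_bij) /char_poly.
(* The product of determinants is read as that of a block triangular matrix with zero corner. *)
rewrite -(det_lblock _ 0) -char_block_diag_mx.
congr (\det (char_poly_mx _)); apply/matrixP => i j; rewrite !mxE /h.
by case: split => a; rewrite !mxE; case: split => b; rewrite !mxE.
Qed.
End CharPoly.

(** * Degrees, edge counts and the signless Laplacian kernel *)

Section Graphs.

Lemma degreeE (G : sgraph) (x : G) : degree x = (\sum_y adj x y)%N.
Proof. by rewrite /degree cardsE -sum1_card big_mkcond. Qed.

(** Ordered adjacent pairs are grouped by the edge they span; each fibre is [(x, y)] and [(y, x)],
    distinct because there are no loops. *)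
Lemma handshake (G : sgraph) : (\sum_(x : G) degree x = 2 * #|edges G|)%N.
Proof.
under eq_bigr => x _ do rewrite degreeE.
rewrite pair_big /=.
transitivity (\sum_(e : G * G | adj e.1 e.2) 1)%N.
  by rewrite [RHS]big_mkcond.
rewrite (partition_big (fun e : G * G => [set e.1; e.2]) (mem (edges G))) /=.
  rewrite mulnC -sum_nat_const; apply: eq_bigr => S.
  rewrite inE => /existsP[x /existsP[y /andP[xy /eqP ->]]].
  rewrite sum1dep_card.
  have x_neq : x != y by apply: contraTneq xy => ->; rewrite adj_irrefl.
  suff -> : [set e : G * G | adj e.1 e.2 & [set e.1; e.2] == [set x; y]] =
      [set (x, y); (y, x)] by rewrite cards2 xpair_eqE negb_and x_neq.
  apply/setP => -[a b]; rewrite !inE !xpair_eqE /=; apply/andP/orP.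
    case=> ab /eqP eq_ab.
    have a_neq : a != b by apply: contraTneq ab => ->; rewrite adj_irrefl.
    have := set21 a b; have := set22 a b; rewrite eq_ab !inE.
    move=> /orP[]/eqP eq_b /orP[]/eqP eq_a; move: a_neq;
      by rewrite eq_a eq_b !eqxx /=; auto.
  by case=> /andP[/eqP-> /eqP->] //; rewrite adj_sym setUC.
move=> [x y] xy; rewrite inE; apply/existsP; exists x; apply/existsP; exists y.
by rewrite xy /=.
Qed.

Lemma degree_kronecker (G H : sgraph) (u : kronecker G H) :
  degree u = (degree u.1 * degree u.2)%N.
Proof.
rewrite /degree -cardsX; congr #|pred_of_set _|; apply/setP => v.
by rewrite !inE.
Qed.

Lemma degree_complete p (i : complete p) : degree i = p.-1.
Proof.
rewrite -[p in RHS]card_ord -(cardsC1 i) /degree.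
by congr #|pred_of_set _|; apply/setP => j; rewrite !inE eq_sym.
Qed.

Lemma degree_union_inl (G H : sgraph) (x : G) :
  degree (inl x : disjoint_union G H) = degree x.
Proof. by rewrite !degreeE big_sumType /= [X in (_ + X)%N]big1 // addn0. Qed.

Lemma degree_union_inr (G H : sgraph) (x : H) :
  degree (inr x : disjoint_union G H) = degree x.
Proof. by rewrite !degreeE big_sumType /= big1. Qed.

Lemma degree_edgeless p (i : edgeless p) : degree i = 0%N.
Proof. by rewrite degreeE big1. Qed.

Variable C : numClosedFieldType.

Definition signless_kernel (G : sgraph) (x y : G) : C :=
  (degree x)%:R *+ (x == y) + (adj x y)%:R.

Lemma signless_laplacianE (G : sgraph) :
  signless_laplacian C G = kernel_mx (@signless_kernel G).
Proof.
apply/matrixP => i j.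
by rewrite !mxE /signless_kernel (inj_eq enum_val_inj).
Qed.

Lemma signless_kernel_sym (G : sgraph) (x y : G) :
  signless_kernel x y = (signless_kernel y x)^*.
Proof.
rewrite /signless_kernel rmorphD rmorph_nat rmorphMn rmorph_nat adj_sym.
by rewrite [y == x]eq_sym; have [->|] := eqVneq x y.
Qed.
End Graphs.

(** * Spectrum and energy of the product graph *)

Section Energy.
Variables (C : numClosedFieldType) (G : sgraph) (p : nat).
Let H := kronecker (disjoint_union G (edgeless p)) (complete p).

Lemma card_kron_union : #|H| = ((p + #|G|) * p)%N.
Proof. by rewrite card_prod card_sum !card_ord addnC. Qed.

Lemma degree_kron_inl (x : G) (i : 'I_p) :
  degree ((inl x, i) : H) = (degree x * p.-1)%N.
Proof. by rewrite degree_kronecker degree_union_inl degree_complete. Qed.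

Lemma degree_kron_inr (x i : 'I_p) : degree ((inr x, i) : H) = 0%N.
Proof. by rewrite degree_kronecker degree_union_inr degree_edgeless. Qed.

(** The degree sum of [H], and also the trace of its signless Laplacian. *)
Let T := (p * p.-1 * (2 * #|edges G|))%N.

Lemma sum_degree_kron_inl : (\sum_(u : G * 'I_p) degree u.1 * p.-1 = T)%N.
Proof.
rewrite -(pair_big xpredT xpredT (fun x _ => degree x * p.-1)%N) /=.
under eq_bigr => x _ do rewrite sum_nat_const card_ord mulnCA mulnC.
by rewrite -big_distrr /= handshake.
Qed.

Lemma edges_kron_union : (2 * #|edges H| = T)%N.
Proof.
rewrite -handshake -sum_degree_kron_inl.
rewrite -(pair_big xpredT xpredT (fun u i => degree ((u, i) : H))) /=.
rewrite big_sumType /= [X in (_ + X)%N]big1 => [|x _]; last first.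
  by rewrite big1 // => i _; rewrite degree_kron_inr.
rewrite addn0 pair_big /=; apply: eq_bigr => -[x i] _ /=.
exact: degree_kron_inl.
Qed.

Let K (u v : G * 'I_p) : C :=
  @signless_kernel C H (inl u.1, u.2) (inl v.1, v.2).

(** Vertices of [H] over the edgeless part are isolated, so the matrix splits into the block [K]
    over [G] and a zero block of size p^2. *)
Lemma signless_spectrum_kron_union :
  perm_eq (signless_spectrum C H)
          (spectrum (kernel_mx K) ++ nseq (p * p) 0).
Proof.
apply: prod_XsubC_eq.
rewrite /signless_spectrum -spectrumP signless_laplacianE big_cat /= -spectrumP.
pose phi (w : G * 'I_p + 'I_p * 'I_p) : H :=
  match w with inl u => (inl u.1, u.2) | inr u => (inr u.1, u.2) end.
have phi_bij : bijective phi.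
  exists (fun u : H => match u with
    (inl x, i) => inl (x, i) | (inr x, i) => inr (x, i) end).
    by case=> -[].
  by case=> -[].
rewrite -(char_poly_kernel_bij _ phi_bij) char_poly_kernel_sum; first last.
- by move=> [x i] [y j]; rewrite /signless_kernel /= addr0.
- by move=> [x i] [y j]; rewrite /signless_kernel /= addr0.
congr (_ * _).
(* The zero block is triangular with zero diagonal, so its characteristic polynomial is a power of
   ['X]. *)
rewrite big_nseq -Monoid.iteropE char_poly_trig => [|]; last first.
  apply/is_trig_mxP => i j _; rewrite !mxE /signless_kernel degree_kron_inr.
  by rewrite mul0rn addr0.
under eq_bigr => i _
  do rewrite mxE /signless_kernel degree_kron_inr mul0rn addr0.
by rewrite prodr_const card_ord card_prod card_ord.
Qed.

Hypothesis leGp : (#|G| <= p)%N.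
Let c : C := (2 * #|edges G|)%:R / (p + #|G|)%:R.
Hypothesis ge_c : forall a, a \in signless_spectrum C G -> c <= a.

(** For P the signless kernel of [G] minus [c] on the diagonal, [kron_kernel P] is exactly [K] minus
    (p - 1) [c] on the diagonal. *)
Lemma spectrum_kron_ge a : a \in spectrum (kernel_mx K) -> p.-1%:R * c <= a.
Proof.
move: a; apply/spectrum_ge_psd => [u v|]; first exact: signless_kernel_sym.
move: ge_c; rewrite /signless_spectrum signless_laplacianE.
move/spectrum_ge_psd => /(_ (@signless_kernel_sym C G)) P_psd.
have := @psd_kron_kernel C G 'I_p _ _ P_psd; rewrite card_ord => /(_ leGp) + f.
move=> /(_ f); congr (_ <= _); apply: eq_sform => // -[x i] [y j].
rewrite /kron_kernel /K /signless_kernel card_ord degree_kron_inl /=.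
rewrite /kronecker_adj /= !xpair_eqE /= eqxx adj_irrefl addr0 natrM /=.
have [_|_] := eqVneq i j; last first.
  rewrite !andbF !andbT !mulr0n add0r subr0.
  have [->|_] := eqVneq x y; first by rewrite adj_irrefl.
  by rewrite !mulr0n !mulr1n subr0 add0r.
rewrite !andbF !andbT addr0 -(inj_eq (@inl_inj G 'I_p)) !mulr1n -mulrnBl.
by congr (_ *+ _); ring.
Qed.

(** The average degree 2M/N of [H]. *)
Let mean : C := T%:R / ((p + #|G|) * p)%:R.

(** Over [G] every eigenvalue is at least [mean], so the absolute values drop and the trace [T]
    appears; each of the p^2 zeros contributes [|mean|]. The result depends on [G] only through its
    numbers of vertices and edges. *)
Lemma signless_energy_kron_union :
  signless_energy C H =
  T%:R - (#|G| * p)%:R * mean + (p * p)%:R * `|mean|.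
Proof.
rewrite /signless_energy (perm_big _ signless_spectrum_kron_union) /=.
rewrite edges_kron_union card_kron_union -/mean big_cat big_nseq /=.
congr (_ + _); last first.
  by rewrite sub0r normrN iter_addr_0 mulr_natl.
have meanE : mean = p.-1%:R * c.
  have [p0|p_gt0] := posnP p.
    by rewrite /mean /T p0 !mul0n !mul0r.
  have p_neq0 : p%:R != 0 :> C by rewrite pnatr_eq0 -lt0n.
  have pG_neq0 : p%:R + #|G|%:R != 0 :> C.
    by rewrite -natrD pnatr_eq0 -lt0n addn_gt0 p_gt0.
  by rewrite /mean /c /T !natrM; field; apply/andP.
transitivity (\sum_(x <- spectrum (kernel_mx K)) (x - mean)).
  apply: eq_big_seq => x /spectrum_kron_ge x_ge.
  by rewrite ger0_norm // subr_ge0 meanE.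
rewrite big_split /= sum_spectrum big_const_seq count_predT size_spectrum.
rewrite iter_addr_0 mulNrn.
congr (_ - _); last by rewrite card_prod card_ord mulr_natl.
rewrite -sum_degree_kron_inl natr_sum /mxtrace [RHS]sum_enum_val.
apply: eq_bigr => i _; rewrite mxE /K /signless_kernel eqxx adj_irrefl addr0.
by rewrite degree_kron_inl.
Qed.
End Energy.

(** * The ordered eigenvalue lists and the conclusion *)

(** Induction on [n - i], going down from index [n]. The strict inequality is guarded by [1 < n]
    because for [n = 1] it would mention [mu 0], outside the list. *)
Lemma last_le (C : numClosedFieldType) n (mu : nat -> C) i :
  ((1 < n)%N -> mu n < mu n.-1) ->
  (forall j : nat, (0 < j)%N -> (j.+1 < n)%N -> mu j.+1 <= mu j) ->
  (1 <= i < 1 + n)%N -> mu n <= mu i.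
Proof.
move=> mu_lt mu_le /andP[i_gt0 i_le]; rewrite add1n ltnS in i_le.
elim: {i_le}(n - i)%N {-2}i i_gt0 (subnK i_le) => [|k IHk] j j_gt0 nE.
  by rewrite -nE.
have IH : mu n <= mu j.+1 by apply: IHk => //; rewrite addnS -nE.
apply: le_trans IH _.
have [jn|jn|jn] := ltngtP j.+1 n.
- exact: mu_le.
- by move: jn; rewrite -nE addSn ltnS ltnNge leq_addl.
- by rewrite -[j]/(j.+1.-1) jn ltW // mu_lt // -jn ltnS.
Qed.

(* mu i and lambda i are used for 1 <= i <= n, as in mu^+_1, ..., mu^+_n. *)
Theorem theorem4p15 (C : numClosedFieldType) (G1 G2 : sgraph) (n m p : nat)
    (mu lambda : nat -> C)
    (G1_conn : connected G1) (G2_conn : connected G2)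
    (G1_vertices : #|G1| = n) (G2_vertices : #|G2| = n)
    (G1_edges : #|edges G1| = m) (G2_edges : #|edges G2| = m)
    (mu_spectrum :
       perm_eq [seq mu i | i <- iota 1 n] (signless_spectrum C G1))
    (mu_gt0 : 0 < mu n)
    (mu_lt : (1 < n)%N -> mu n < mu n.-1)
    (mu_le : forall i : nat, (0 < i)%N -> (i.+1 < n)%N -> mu i.+1 <= mu i)
    (lambda_spectrum :
       perm_eq [seq lambda i | i <- iota 1 n] (signless_spectrum C G2))
    (lambda_gt0 : 0 < lambda n)
    (lambda_lt : (1 < n)%N -> lambda n < lambda n.-1)
    (lambda_le :
       forall i : nat, (0 < i)%N -> (i.+1 < n)%N -> lambda i.+1 <= lambda i)
    (p_gt0 : (0 < p)%N) (p_gt : (n < p)%N)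
    (avg_lt : (2 * m)%:R / (p + n)%:R < Num.min (mu n) (lambda n)) :
  signless_energy C (kronecker (disjoint_union G1 (edgeless p)) (complete p)) =
  signless_energy C (kronecker (disjoint_union G2 (edgeless p)) (complete p)).
Proof.
(* The order on [C] is partial, so splitting the minimum requires comparability; positive elements
   are real. *)
have cmp : (mu n >=< lambda n)%O.
  by apply: real_comparable; apply: gtr0_real.
move: avg_lt; rewrite comparable_lt_min // => /andP[c_mu c_lambda].
rewrite !signless_energy_kron_union ?G1_vertices ?G2_vertices ?G1_edges
  ?G2_edges ?(ltnW p_gt) // => a.
- rewrite -(perm_mem lambda_spectrum) => /mapP[i].
  rewrite mem_iota => i_in ->; apply/ltW/(lt_le_trans c_lambda).
  exact: last_le.
- rewrite -(perm_mem mu_spectrum) => /mapP[i].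
  rewrite mem_iota => i_in ->; apply/ltW/(lt_le_trans c_mu).
  exact: last_le.
Qed.
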